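(* Let $M^3$ be a minimal translation hypersurface of type 4 in $\mathbb{I}^4$, i.e. $M^3$ is parameterized by $$r(u,v,w)=\left(f(u)+g(v)+h(w),\ u+v+6w,\ u+v-w,\ u-v+w+\tfrac{5\pi}{6}\right)$$ with $f,g,h$ smooth real functions of one variable and $f'(u)-g'(v)\neq0$, and its isotropic mean curvature $H$ vanishes identically. Then $M^3$ is either a non-isotropic hyperplane or, for some $\lambda,\mu,\xi\in\mathbb{R}$, one of the following occurs (up to translations of the parameters, additive constants, and interchanging the roles of $f$ and $g$): (i) $f(u)=\lambda u$, $g(v)=\lambda v-\frac1\mu\ln|\mu v|$, $h(w)=\frac{5\lambda}{2}w+\frac1\mu\ln|\cos\xi w|$, $\mu\xi\neq0$; (ii) $f(u)=\lambda u-\frac1\mu\ln|\cos\xi u|$, $g(v)=\lambda v+\frac1\mu\ln|\cos\xi v|$, $h(w)=\frac{37\lambda}{5}w$, $\mu\xi\neq0$.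
   Context: The isotropic space $\mathbb{I}^4$ is $\mathbb{R}^4$ with affine coordinates $(x_1,\dots,x_4)$ and the degenerate metric $dx_1^2+dx_2^2+dx_3^2$. A hyperplane is non-isotropic if it is not parallel to the $x_4$-axis; all hypersurfaces considered have non-isotropic tangent hyperplanes. For a parameterized hypersurface $r$, let $[g_{ij}]$ be the matrix of the first fundamental form induced by the degenerate metric and $h_{ij}=\det(r_u,r_v,r_w,r_{ij})/\sqrt{\det g_{ij}}$, with $r_{ij}$ the second partial derivatives. The isotropic mean curvature $H$ is defined by $3H=\mathrm{tr}([h_{ij}][g_{ij}]^{-1})$. For a type 4 hypersurface (with the sign convention used here) $$3H=\frac{2}{49(f'-g')^3}\Big\{\left[37(g')^2+2(h')^2-10g'h'+49\right]f''+\left[37(f')^2+2(h')^2-10f'h'+49\right]g''+2h''(f'-g')^2\Big\}.$$ ''Up to translations of the parameters and additive constants'' means that each of $f,g,h$ may be replaced by $\varphi(t+t_0)+c$ with $t_0,c\in\mathbb{R}$. *)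

(* Defs.v *)
From HB Require Import structures.
From mathcomp Require Import all_boot all_order all_algebra.
From mathcomp Require Import all_classical all_reals all_analysis.

Set Implicit Arguments.
Unset Strict Implicit.
Unset Printing Implicit Defensive.

Import Order.TTheory GRing.Theory Num.Theory.
Import numFieldNormedType.Exports.

Local Open Scope ring_scope.
Local Open Scope classical_set_scope.

(* Points of the isotropic space I^4 are row vectors; the coordinates
   x_1, ..., x_4 are the entries of index 0, ..., 3. *)

(* The degenerate metric dx_1^2 + dx_2^2 + dx_3^2. *)
Definition iso_dot (R : realType) (x y : 'rV[R]_4) : R :=
  \sum_(k < 4 | (k < 3)%N) x 0 k * y 0 k.

Definition partial (R : realType) (i : 'I_3) (r : 'rV[R]_3 -> 'rV[R]_4)
    (p : 'rV[R]_3) : 'rV[R]_4 :=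
  'D_(delta_mx 0 i) r p.

Definition first_form (R : realType) (r : 'rV[R]_3 -> 'rV[R]_4)
    (p : 'rV[R]_3) : 'M[R]_3 :=
  \matrix_(i, j) iso_dot (partial i r p) (partial j r p).

(* The vectors r_u, r_v, r_w, r_ij are the rows of the determinant, and the
   square root is the nonnegative one: no orientation sign is inserted. *)
Definition second_form (R : realType) (r : 'rV[R]_3 -> 'rV[R]_4)
    (p : 'rV[R]_3) : 'M[R]_3 :=
  \matrix_(i, j)
    (\det (col_mx (\matrix_(k < 3) partial k r p)
                  (partial j (partial i r) p) : 'M[R]_4)
     / Num.sqrt (\det (first_form r p))).

Definition mean_curvature (R : realType) (r : 'rV[R]_3 -> 'rV[R]_4)
    (p : 'rV[R]_3) : R :=
  \tr (second_form r p *m invmx (first_form r p)) / 3.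

Definition translation_type4 (R : realType) (f g h : R -> R)
    (p : 'rV[R]_3) : 'rV[R]_4 :=
  let u := p 0 0 in let v := p 0 1 in let w := p 0 2 in
  \row_(k < 4) nth 0 [:: f u + g v + h w;
                         u + v + 6 * w;
                         u + v - w;
                         u - v + w + 5 * pi / 6] k.

Definition open_interval (R : realType) (I : set R) : Prop :=
  [/\ open I, is_interval I & I !=set0].

Definition smooth_on (R : realType) (I : set R) (f : R -> R) : Prop :=
  forall (n : nat) (x : R), I x -> derivable (f^`(n)) x 1.

Definition box (R : realType) (I J K : set R) : set 'rV[R]_3 :=
  [set p : 'rV[R]_3 | [/\ I (p 0 0), J (p 0 1) & K (p 0 2)]].

Definition hyperplane (R : realType) (n : 'rV[R]_4) (d : R) : set 'rV[R]_4 :=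
  [set x : 'rV[R]_4 | \sum_(k < 4) n 0 k * x 0 k = d].

Definition parallel_to_x4_axis (R : realType) (P : set 'rV[R]_4) : Prop :=
  forall (x : 'rV[R]_4) (t : R), P x -> P (x + t *: delta_mx 0 ord_max).

Definition nonisotropic_hyperplane (R : realType) (P : set 'rV[R]_4) : Prop :=
  (exists (n : 'rV[R]_4) (d : R), n != 0 /\ P = hyperplane n d) /\
  ~ parallel_to_x4_axis P.

(* Hypersurfaces are parameterized over boxes of open intervals, so "is a
   hyperplane" means being a relatively open part of it. *)
Definition open_part (R : realType) (P M : set 'rV[R]_4) : Prop :=
  exists U : set 'rV[R]_4, open U /\ M = P `&` U.

(* On I, f is phi up to a translation of the parameter and an additive
   constant; D is the natural domain of the expression phi, needed because
   [ln] is total with ln 0 = 0. *)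
Definition same_up_to (R : realType) (I : set R) (f : R -> R)
    (D : set R) (phi : R -> R) : Prop :=
  exists t0 c : R, forall t, I t -> D (t + t0) /\ f t = phi (t + t0) + c.

Definition case_i (R : realType) (lambda mu xi : R) (I J K : set R)
    (f g h : R -> R) : Prop :=
  [/\ mu * xi != 0,
      same_up_to I f setT (fun u => lambda * u),
      same_up_to J g [set v | mu * v != 0]
        (fun v => lambda * v - mu^-1 * ln `|mu * v|) &
      same_up_to K h [set w | cos (xi * w) != 0]
        (fun w => 5 * lambda / 2 * w + mu^-1 * ln `|cos (xi * w)|)].

Definition case_ii (R : realType) (lambda mu xi : R) (I J K : set R)
    (f g h : R -> R) : Prop :=
  [/\ mu * xi != 0,
      same_up_to I f [set u | cos (xi * u) != 0]
        (fun u => lambda * u - mu^-1 * ln `|cos (xi * u)|),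
      same_up_to J g [set v | cos (xi * v) != 0]
        (fun v => lambda * v + mu^-1 * ln `|cos (xi * v)|) &
      same_up_to K h setT (fun w => 37 * lambda / 5 * w)].

(* Main.v *)
(* With p = f', q = g', s = h', minimality of a type 4 hypersurface is the
   equation
     (37 q^2 - 10 q s + 2 s^2 + 49) f'' + (37 p^2 - 10 p s + 2 s^2 + 49) g''
       + 2 (p - q)^2 h'' = 0
   in the three independent variables u, v, w.  It is quadratic in s, and
   comparing coefficients shows that one of f'', g'', h'' vanishes identically.
   The remaining two variables then separate into Riccati equations with
   constant coefficients, Y' = k Y^2 or Y' = m Y^2 + x^2 / m, whose solutions
   are -1/(k t) and (x / m) tan(x t); their primitives give the two families,
   and a zero separation constant gives the hyperplanes. *)

Require Import Defs.
From HB Require Import structures.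
From mathcomp Require Import all_boot all_order all_algebra.
From mathcomp Require Import all_classical all_reals all_analysis.
From mathcomp Require Import ring lra.
Import Order.TTheory GRing.Theory Num.Theory.
Import numFieldNormedType.Exports.
Local Open Scope ring_scope.
Local Open Scope classical_set_scope.

(** * Functions of one variable *)

Section OpenInterval.
Context {R : realType} {I : set R}.
Hypothesis hI : open_interval I.

Lemma within_continuous_segment (f : R -> R) (x y : R) :
  (forall t, I t -> derivable f t 1) -> I x -> I y ->
  {within `[x, y], continuous f}.
Proof.
case: hI => _ itvI _ df Ix Iy.
apply: derivable_within_continuous => t; rewrite in_itv /= => xty.
exact/df/(itvI x y).
Qed.

Lemma is_derive0_cst (f : R -> R) (x y : R) :
  (forall t, I t -> is_derive t 1 f 0) -> I x -> I y -> f x = f y.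
Proof.
move=> df; wlog xy : x y / x <= y => [hw Ix Iy|Ix Iy].
  by have [/hw|/ltW/hw ->] := leP x y => //; apply.
have dfI t : I t -> derivable f t 1 by move=> /df[].
case: hI => _ itvI _.
have [t|c _] := @MVT_segment R f (cst 0) x y xy _
  (within_continuous_segment _ _ _ dfI Ix Iy).
  rewrite in_itv /= => /andP[xt ty]; apply/df/(itvI x y) => //.
  by rewrite !ltW.
by rewrite mul0r => /eqP; rewrite subr_eq0 => /eqP.
Qed.

Lemma eq_cst_of_derive0 (y dy : R -> R) :
  (forall t, I t -> is_derive t 1 y (dy t)) -> (forall t, I t -> dy t = 0) ->
  exists a, forall t, I t -> y t = a.
Proof.
move=> dyE y0; have [_ _ [r Ir]] := hI; exists (y r) => t It.
by apply: is_derive0_cst => // x Ix; rewrite -(y0 _ Ix); exact: dyE.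
Qed.

Lemma is_derive_affine (f : R -> R) (a : R) :
  (forall t, I t -> is_derive t 1 f a) ->
  exists c, forall t, I t -> f t = a * t + c.
Proof.
move=> df; have [_ _ [x Ix]] := hI; exists (f x - a * x) => t It.
have dg s : I s -> is_derive s 1 (f - ( *%R a)) 0.
  move=> Is; have ? := df s Is.
  have ? : is_derive s 1 ( *%R a) a.
    by apply: is_derive_eq; exact: mulr1.
  by apply: is_derive_eq; rewrite subrr.
have := is_derive0_cst _ t x dg It Ix.
by rewrite !fctE; lra.
Qed.

(** Openness of [I] makes [f] constant near [t], and the derivative depends only on nearby
    values. *)
Lemma is_derive_cst_on (f : R -> R) (a d t : R) :
  (forall t, I t -> f t = a) -> I t -> is_derive t 1 f d -> d = 0.
Proof.
case: hI => oI _ _ fa It [_ <-].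
rewrite (@near_eq_derive _ _ _ f (cst a)) ?derive_cst//.
by have := open_nbhs_nbhs (conj oI It); apply: filterS => s /fa.
Qed.

(** * Primitives of the solutions of the two Riccati equations *)

Lemma is_derive_ln_comp (f : R -> R) (t df : R) :
  0 < f t -> is_derive t 1 f df -> is_derive t 1 (@ln R \o f) (df / f t).
Proof.
move=> f0 dft; have dln := is_derive1_ln f0.
by apply: is_derive_eq; rewrite mulrC.
Qed.

Lemma same_up_to_affine (f : R -> R) (a : R) :
  (forall t, I t -> is_derive t 1 f a) ->
  same_up_to I f setT (fun t => a * t).
Proof.
move=> /is_derive_affine[c fE]; exists 0, c => t It.
by rewrite addr0; split => //; exact: fE.
Qed.

(** The equation Y' = k Y^2 linearizes to (1/Y)' = -k, and ln(Y^2) has derivative 2 k Y, so it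
    integrates [Y]. *)
Lemma same_up_to_ln (f Y : R -> R) (a k : R) : k != 0 ->
  (forall t, I t -> Y t != 0) ->
  (forall t, I t -> is_derive t 1 f (a + Y t)) ->
  (forall t, I t -> is_derive t 1 Y (k * Y t ^+ 2)) ->
  same_up_to I f [set t | k * t != 0] (fun t => a * t - k^-1 * ln `|k * t|).
Proof.
move=> k0 Y0 df dY.
have [b Yb] : exists b, forall t, I t -> (Y t)^-1 = - k * t + b.
  apply: is_derive_affine => t It.
  have Y0t := Y0 t It.
  apply: is_derive_eq (is_deriveV Y0t (dY t It)) _.
  by rewrite /GRing.scale /=; field.
have [c fc] : exists c, forall t, I t ->
    (f - (2 * k)^-1 *: (@ln R \o (Y * Y))) t = a * t + c.
  apply: is_derive_affine => t It; have ? := dY t It; have ? := df t It.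
  have Y0t := Y0 t It.
  (* The square keeps the argument of the logarithm positive whatever the sign of [Y]. *)
  have Y2 : 0 < (Y * Y) t by rewrite !fctE -expr2 exprn_even_gt0.
  have ? := is_derive_ln_comp _ _ _ Y2 (is_deriveM (dY t It) (dY t It)).
  by apply: is_derive_eq; rewrite !fctE /GRing.scale /=; field; rewrite Y0t k0.
exists (- b / k), (c + a * b / k) => t It.
have kt : k * (t + - b / k) = - (Y t)^-1.
  by rewrite Yb//; field.
split; first by rewrite /= kt oppr_eq0 invr_neq0// Y0.
have := fc t It; rewrite !fctE /= -expr2 => /eqP.
rewrite subr_eq => /eqP ->.
rewrite kt normrN normfV lnV ?posrE ?normr_gt0 ?Y0//.
rewrite -(real_normK (num_real (Y t))) lnXn ?normr_gt0 ?Y0//.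
by rewrite /GRing.scale /=; field.
Qed.

(** With Z = 1 + (m Y / x)^2 the equation reads Y' = x^2 Z / m. Hence atan(m Y / x) has derivative
    x, so it is affine, and ln Z has derivative 2 m Y, so it integrates [Y]. *)
Lemma same_up_to_ln_cos (f Y : R -> R) (a m x : R) : m != 0 -> x != 0 ->
  (forall t, I t -> is_derive t 1 f (a + Y t)) ->
  (forall t, I t -> is_derive t 1 Y (m * Y t ^+ 2 + x ^+ 2 / m)) ->
  same_up_to I f [set t | cos (x * t) != 0]
    (fun t => a * t - m^-1 * ln `|cos (x * t)|).
Proof.
move=> m0 x0 df dY.
pose Z := cst 1 + (m / x) ^+ 2 *: (Y * Y).
have ZE t : Z t = 1 + (m / x * Y t) ^+ 2.
  by rewrite /Z !fctE /GRing.scale /=; ring.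
have Z0 t : 0 < Z t by rewrite ZE ltr_wpDr ?sqr_ge0.
have Z1 t : x ^+ 2 + (m * Y t) ^+ 2 != 0.
  by rewrite gt_eqF// ltr_wpDr ?sqr_ge0// exprn_even_gt0.
have [b Yb] : exists b, forall t, I t ->
    (@atan R \o (m / x *: Y)) t = x * t + b.
  apply: is_derive_affine => t It.
  have dmY := is_deriveZ (m / x) (dY t It).
  have dat : is_derive ((m / x *: Y) t) 1 (@atan R) (1 + (m / x * Y t) ^+ 2)^-1.
    exact: is_derive1_atan.
  apply: is_derive_eq (is_derive1_comp dat dmY) _.
  rewrite /GRing.scale /=; field.
  by rewrite x0 m0 Z1.
have [c fc] : exists c, forall t, I t ->
    (f - (2 * m)^-1 *: (@ln R \o Z)) t = a * t + c.
  apply: is_derive_affine => t It; have dYt := dY t It.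
  have dYY := is_deriveZ ((m / x) ^+ 2) (is_deriveM dYt dYt).
  have dZ := is_deriveD (is_derive_cst (1 : R) t 1) dYY.
  have dlnZ := is_derive_ln_comp _ _ _ (Z0 t) dZ.
  apply: is_derive_eq (is_deriveB (df t It) (is_deriveZ (2 * m)^-1 dlnZ)) _.
  rewrite ZE /GRing.scale /=; field.
  by rewrite x0 m0 Z1.
exists (b / x), (c - a * b / x) => t It.
have xt : x * (t + b / x) = atan (m / x * Y t).
  have := Yb t It; rewrite /= !fctE /GRing.scale /= => ->.
  by field.
(* An arctangent lies strictly between -pi/2 and pi/2, so the cosine stays positive on all of
   [I]. *)
have cos0 : 0 < cos (atan (m / x * Y t)).
  by rewrite cos_atan invr_gt0 sqrtr_gt0 ltr_wpDr ?sqr_ge0.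
split; first by rewrite /= xt gt_eqF.
have := fc t It; rewrite !fctE /= ZE => /eqP.
rewrite subr_eq => /eqP ->.
(* Since 1 + tan^2 = cos^-2, the logarithm of [Z] is -2 ln cos. *)
rewrite xt gtr0_norm// -{1}(atanK (m / x * Y t)) -cos2_tan2 ?gt_eqF//.
rewrite lnV ?posrE ?exprn_gt0// lnXn//.
by rewrite /GRing.scale /=; field; rewrite m0 x0.
Qed.

End OpenInterval.

(** * Quadratic polynomials and three distinct values *)

Lemma third_value {R : realType} {I : set R} (hI : open_interval I)
    (Y : R -> R) (s t : R) :
  (forall t, I t -> derivable Y t 1) -> I s -> I t ->
  exists2 r, I r & Y r = (Y s + Y t) / 2.
Proof.
move=> dY; wlog st : s t / s <= t => [hw Is It|Is It].
  have [st|/ltW ts] := leP s t; first exact: hw.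
  by rewrite addrC; exact: hw.
have cY := within_continuous_segment hI _ s t dY Is It.
have mid : Num.min (Y s) (Y t) <= (Y s + Y t) / 2 <= Num.max (Y s) (Y t).
  by rewrite /Num.min /Num.max; case: ltP => ?; lra.
have [r + Yr] := IVT st cY mid; rewrite in_itv /= => srt.
by exists r => //; case: hI => _ itvI _; exact: (itvI s t).
Qed.

(** Divided differences give a (s1 + s2) + b = a (s1 + s3) + b = 0, and one more difference isolates
    [a]. *)
Lemma quadratic_eq0 {R : realFieldType} (a b c s1 s2 s3 : R) :
  s1 != s2 -> s1 != s3 -> s2 != s3 ->
  a * s1 ^+ 2 + b * s1 + c = 0 -> a * s2 ^+ 2 + b * s2 + c = 0 ->
  a * s3 ^+ 2 + b * s3 + c = 0 -> a = 0 /\ b = 0.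
Proof.
rewrite -subr_eq0 -(subr_eq0 s1 s3) -(subr_eq0 s2 s3) => n12 n13 n23 e1 e2 e3.
have e12 : a * (s1 + s2) + b = 0 by apply: (mulfI n12); rewrite mulr0; lra.
have e13 : a * (s1 + s3) + b = 0 by apply: (mulfI n13); rewrite mulr0; lra.
have a0 : a = 0 by apply: (mulfI n23); rewrite mulr0; lra.
by split=> //; move: e12; rewrite a0 mul0r add0r.
Qed.

Lemma quadratic_interpolation {R : realFieldType} (s1 s2 s3 x1 x2 x3 : R) :
  s1 != s2 -> s1 != s3 -> s2 != s3 ->
  exists a b c : R, [/\ x1 = a * s1 ^+ 2 + b * s1 + c,
    x2 = a * s2 ^+ 2 + b * s2 + c & x3 = a * s3 ^+ 2 + b * s3 + c].
Proof.
rewrite -subr_eq0 -(subr_eq0 s1 s3) -(subr_eq0 s2 s3) => n12 n13 n23.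
(* Newton interpolation: [d] and [a] are the first and second divided differences. *)
pose d := (x1 - x2) / (s1 - s2).
pose a := (d - (x1 - x3) / (s1 - s3)) / (s2 - s3).
exists a, (d - a * (s1 + s2)), (x1 - a * s1 ^+ 2 - (d - a * (s1 + s2)) * s1).
by split; rewrite /a /d; field; rewrite n12 ?n13 ?n23.
Qed.

(** * The equation of minimality *)

(* With p = f', q = g', s = h', the cofactors of the diagonal entries of the
   first fundamental form are [curv_coef q s], [curv_coef p s] and
   [2 (p - q)^2]. *)
Definition curv_coef {R : realType} (a s : R) : R :=
  37 * a ^+ 2 + 2 * s ^+ 2 - 10 * a * s + 49.

Definition minimal_eq {R : realType} (I J K : set R)
    (p dp q dq s ds : R -> R) : Prop :=
  forall u v w, I u -> J v -> K w ->
    curv_coef (q v) (s w) * dp u + curv_coef (p u) (s w) * dq v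
    + 2 * (p u - q v) ^+ 2 * ds w = 0.

(** The case where f, g and h are all affine, which leads to the hyperplanes. *)
Definition flat {R : realType} (I J K : set R) (dp dq ds : R -> R) : Prop :=
  [/\ forall u, I u -> dp u = 0, forall v, J v -> dq v = 0 &
      forall w, K w -> ds w = 0].

Lemma minimal_eqC {R : realType} (I J K : set R) (p dp q dq s ds : R -> R) :
  minimal_eq I J K p dp q dq s ds -> minimal_eq J I K q dq p dp s ds.
Proof. by move=> E u v w Ju Iv Kw; rewrite -[RHS](E v u w Iv Ju Kw); ring. Qed.

Lemma curv_coef_gt0 {R : realType} (a s : R) : 0 < curv_coef a s.
Proof.
(* Complete the square in [a]. *)
have -> : curv_coef a s =
    37^-1 * (37 * a - 5 * s) ^+ 2 + 49 / 37 * s ^+ 2 + 49.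
  by rewrite /curv_coef; field.
by rewrite ltr_wpDl// addr_ge0// mulr_ge0// sqr_ge0.
Qed.

Section MinimalEquation.
Context {R : realType} {I J K : set R} {f p dp g q dq h s ds : R -> R}.
Hypotheses (hI : open_interval I) (hJ : open_interval J) (hK : open_interval K).
Hypotheses (df : forall t, I t -> is_derive t 1 f (p t))
  (dp' : forall t, I t -> is_derive t 1 p (dp t))
  (dg : forall t, J t -> is_derive t 1 g (q t))
  (dq' : forall t, J t -> is_derive t 1 q (dq t))
  (dh : forall t, K t -> is_derive t 1 h (s t))
  (ds' : forall t, K t -> is_derive t 1 s (ds t)).
Hypothesis hreg : forall u v : R, I u -> J v -> p u - q v != 0.
Hypothesis E : minimal_eq I J K p dp q dq s ds.

(* Along w the equation is polynomial in s = h', so h'' interpolates to a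
   polynomial a s^2 + b s + c at three values of s, and comparing
   coefficients gives f'' + g'' = - a (p - q)^2 and
   5 (q f'' + p g'') = b (p - q)^2.  The mixed second difference of the former
   gives a = 0, so that f'' = - g'' is constant; the latter then gives b = 0
   and f'' = 0. *)
Lemma second_derivative_vanishes :
  [\/ forall u, I u -> dp u = 0, forall v, J v -> dq v = 0 |
      forall w, K w -> ds w = 0].
Proof.
(* If no alternative holds, each of f', g', h' takes two distinct values. *)
have nonconstant (L : set R) (hL : open_interval L) (y dy : R -> R) :
    (forall t, L t -> is_derive t 1 y (dy t)) ->
    ~ (forall t, L t -> dy t = 0) ->
    exists t1 t2, [/\ L t1, L t2 & y t1 != y t2].
  move=> dyE y0; apply: contrapT => yc; apply: y0 => t Lt.
  apply: (is_derive_cst_on hL y (y t) (dy t) t) => // [r Lr|]; last exact: dyE.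
  by apply: contrapT => /eqP rt; apply: yc; exists r, t.
apply: contrapT => noalt.
have [u1 [u2 [Iu1 Iu2 pu]]] : exists t1 t2, [/\ I t1, I t2 & p t1 != p t2].
  by apply: nonconstant hI _ _ dp' _ => H; apply: noalt; exact: Or31.
have [v1 [v2 [Jv1 Jv2 qv]]] : exists t1 t2, [/\ J t1, J t2 & q t1 != q t2].
  by apply: nonconstant hJ _ _ dq' _ => H; apply: noalt; exact: Or32.
have [w1 [w2 [Kw1 Kw2 sw]]] : exists t1 t2, [/\ K t1, K t2 & s t1 != s t2].
  by apply: nonconstant hK _ _ ds' _ => H; apply: noalt; exact: Or33.
have ds0 t : K t -> derivable s t 1 by move=> Kt; case: (ds' t Kt).
(* The mean of two distinct values of h' is a third one, reached by the intermediate value theorem;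
   a quadratic in s needs three. *)
have [w3 Kw3 sw3] := third_value hK _ _ _ ds0 Kw1 Kw2.
have sw13 : s w1 != s w3.
  by move: sw; rewrite sw3; apply: contra_neq => ?; lra.
have sw23 : s w2 != s w3.
  by move: sw; rewrite sw3; apply: contra_neq => ?; lra.
have [a [b [c [h1 h2 h3]]]] := quadratic_interpolation _ _ _
  (ds w1) (ds w2) (ds w3) sw sw13 sw23.
(* The interpolant does not depend on [u] and [v]. Substituting it for h'' gives a quadratic in s
   with three distinct roots, whose two leading coefficients must vanish. *)
have coefs u v : I u -> J v ->
    2 * (dp u + dq v + a * (p u - q v) ^+ 2) = 0 /\
    - 10 * (q v * dp u + p u * dq v) + 2 * b * (p u - q v) ^+ 2 = 0.
  move=> Iu Jv.
  have e1 := E u v w1 Iu Jv Kw1; have e2 := E u v w2 Iu Jv Kw2.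
  have e3 := E u v w3 Iu Jv Kw3.
  apply: (quadratic_eq0 _ _
    ((37 * q v ^+ 2 + 49) * dp u + (37 * p u ^+ 2 + 49) * dq v
     + 2 * c * (p u - q v) ^+ 2) _ _ _ sw sw13 sw23).
  - by rewrite -e1 h1 /curv_coef; ring.
  - by rewrite -e2 h2 /curv_coef; ring.
  - by rewrite -e3 h3 /curv_coef; ring.
have a0 : a = 0.
  have [e11 _] := coefs _ _ Iu1 Jv1; have [e12 _] := coefs _ _ Iu1 Jv2.
  have [e21 _] := coefs _ _ Iu2 Jv1; have [e22 _] := coefs _ _ Iu2 Jv2.
  (* In the alternating sum over the four corners f'' + g'' cancels, and only the cross term of (p -
     q)^2 survives. *)
  have : a * ((p u1 - p u2) * (q v1 - q v2)) = 0 by lra.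
  move/eqP; rewrite !mulf_eq0 !subr_eq0 (negbTE pu) (negbTE qv) !orbF.
  by move=> /eqP.
have fg u v : I u -> J v -> dp u = - dq v.
  by move=> Iu Jv; have [+ _] := coefs _ _ Iu Jv; rewrite a0; lra.
(* With g'' = - f'' the sum q f'' + p g'' becomes -(p - q) f'', so a factor p - q cancels. *)
have fb u : I u -> 5 * dp u + b * (p u - q v1) = 0.
  move=> Iu; have [_ +] := coefs _ _ Iu Jv1.
  have -> : dq v1 = - dp u by rewrite (fg u v1)// opprK.
  by move=> e; apply: (mulfI (hreg _ _ Iu Jv1)); rewrite mulr0; lra.
have b0 : b = 0.
  have e1 := fb _ Iu1; have e2 := fb _ Iu2; have f1 := fg _ _ Iu1 Jv1.
  have f2 := fg _ _ Iu2 Jv1.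
  have : b * (p u1 - p u2) = 0 by lra.
  by move/eqP; rewrite mulf_eq0 subr_eq0 (negbTE pu) orbF => /eqP.
apply: noalt; apply: Or31 => u Iu.
by have := fb _ Iu; rewrite b0; lra.
Qed.

(** With h' = c and A(a) = [curv_coef a c], the variables separate: f'' / A(f') = - g'' / A(g') = k.
    Since A(a) = 37 (a - 5c/37)^2 + 49 (c^2 + 37) / 37, both f' - 5c/37 and g' - 5c/37 solve
    tangent-type Riccati equations, with opposite signs; k = 0 is the flat case. *)
Lemma minimal_h_affine :
  (forall w, K w -> ds w = 0) ->
  flat I J K dp dq ds \/ exists lambda mu xi, case_ii lambda mu xi I J K f g h.
Proof.
move=> h0; have [c hs] := eq_cst_of_derive0 hK _ _ ds' h0.
have [[_ _ [u0 Iu0]] [_ _ [w0 Kw0]]] := (hI, hK).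
have A0 a : curv_coef a c != 0 by rewrite gt_eqF// curv_coef_gt0.
pose k := dp u0 / curv_coef (p u0) c.
have gk v : J v -> dq v = - k * curv_coef (q v) c.
  move=> Jv; have := E _ _ _ Iu0 Jv Kw0; rewrite h0// hs// mulr0 addr0 => e.
  apply: (mulfI (A0 (p u0))); apply/eqP.
  by rewrite -subr_eq0 -[X in _ == X]e; apply/eqP; rewrite /k; field.
have fk u : I u -> dp u = k * curv_coef (p u) c.
  have [_ _ [v0 Jv0]] := hJ.
  move=> Iu; have := E _ _ _ Iu Jv0 Kw0.
  rewrite h0// hs// gk// mulr0 addr0 => e.
  apply: (mulfI (A0 (q v0))); apply/eqP.
  by rewrite -subr_eq0 -[X in _ == X]e; apply/eqP; ring.
have [k0|k0] := eqVneq k 0.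
  by left; split=> // t Lt; rewrite ?fk ?gk// k0 ?oppr0 mul0r.
(* [x ^+ 2] is the product of the leading coefficient 37 k and the constant term 49 k (c^2 + 37) /
   37 of the Riccati equation. *)
right; pose x := 7 * k * Num.sqrt (c ^+ 2 + 37).
have s0 : 0 < c ^+ 2 + 37 by nra.
have r0 : Num.sqrt (c ^+ 2 + 37) != 0 by rewrite gt_eqF ?sqrtr_gt0.
have x0 : x != 0 by rewrite mulf_neq0// mulf_neq0// pnatr_eq0.
have x2 : x ^+ 2 = 49 * k ^+ 2 * (c ^+ 2 + 37).
  by rewrite /x exprMn sqr_sqrtr ?ltW//; ring.
have m0 : 37 * k != 0 by rewrite mulf_neq0 ?pnatr_eq0.
exists (5 * c / 37), (37 * k), x; split.
- by rewrite mulf_neq0.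
- apply: (same_up_to_ln_cos hI f (p - cst (5 * c / 37))
    (5 * c / 37) _ _ m0 x0) => t It.
    by apply: is_derive_eq (df t It) _; rewrite !fctE subrKC.
  have dpt := dp' t It; apply: is_derive_eq.
  by rewrite x2 fk// !fctE /curv_coef; field.
(* For g' the coefficient is -37 k, which flips the sign of the logarithm and leaves [x]
   unchanged. *)
- have -> : (fun v => 5 * c / 37 * v + (37 * k)^-1 * ln `|cos (x * v)|) =
    (fun v => 5 * c / 37 * v - (- (37 * k))^-1 * ln `|cos (x * v)|).
    by apply/funext => v; rewrite invrN mulNr opprK.
  have m0' : - (37 * k) != 0 by rewrite oppr_eq0.
  apply: (same_up_to_ln_cos hJ g (q - cst (5 * c / 37))
    (5 * c / 37) _ _ m0' x0) => t Jt.
    by apply: is_derive_eq (dg t Jt) _; rewrite !fctE subrKC.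
  have dqt := dq' t Jt; apply: is_derive_eq.
  by rewrite x2 gk// !fctE /curv_coef; field.
- apply: (same_up_to_affine hK) => t Kt.
  by apply: is_derive_eq (dh t Kt) _; rewrite hs//; field.
Qed.

(** With f' = c and A(a) = [curv_coef c a], the variables separate: g'' = k (c - g')^2 and h'' =
    -(k/2) A(h'). Since A(a) = 2 (a - 5c/2)^2 + 49 (c^2 + 2) / 2, g' - c solves the purely quadratic
    equation and h' - 5c/2 the tangent-type one with m = -k. *)
Lemma minimal_f_affine :
  (forall u, I u -> dp u = 0) ->
  flat I J K dp dq ds \/ exists lambda mu xi, case_i lambda mu xi I J K f g h.
Proof.
move=> f0; have [c fp] := eq_cst_of_derive0 hI _ _ dp' f0.
have [[_ _ [u0 Iu0]] [_ _ [v0 Jv0]]] := (hI, hJ).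
have q0 v : J v -> c - q v != 0.
  by move=> Jv; rewrite -(fp u0)// hreg.
have A0 a : curv_coef c a != 0 by rewrite gt_eqF// curv_coef_gt0.
pose k := dq v0 / (c - q v0) ^+ 2.
have hk w : K w -> ds w = - (k / 2) * curv_coef c (s w).
  move=> Kw; have := E _ _ _ Iu0 Jv0 Kw; rewrite f0// fp// mulr0 add0r => e.
  have pq : 2 * (c - q v0) ^+ 2 != 0.
    by rewrite mulf_neq0 ?expf_neq0 ?q0// pnatr_eq0.
  apply: (mulfI pq); apply/eqP.
  rewrite -subr_eq0 -[X in _ == X]e; apply/eqP; rewrite /k; field.
  exact: q0.
have gk v : J v -> dq v = k * (c - q v) ^+ 2.
  have [_ _ [w0 Kw0]] := hK.
  move=> Jv; have := E _ _ _ Iu0 Jv Kw0.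
  rewrite f0// fp// hk// mulr0 add0r => e.
  apply: (mulfI (A0 (s w0))); apply/eqP.
  by rewrite -subr_eq0 -[X in _ == X]e; apply/eqP; field.
have [k0|k0] := eqVneq k 0.
  by left; split=> // t Lt; rewrite ?hk ?gk// k0 !(mul0r, oppr0).
right; pose x := 7 / 2 * k * Num.sqrt (c ^+ 2 + 2).
have p0 : 0 < c ^+ 2 + 2 by nra.
have r0 : Num.sqrt (c ^+ 2 + 2) != 0 by rewrite gt_eqF ?sqrtr_gt0.
have x0 : x != 0.
  by rewrite mulf_neq0// mulf_neq0// mulf_neq0// ?invr_neq0// pnatr_eq0.
have x2 : x ^+ 2 = 49 / 4 * k ^+ 2 * (c ^+ 2 + 2).
  by rewrite /x exprMn sqr_sqrtr ?ltW//; field.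
exists c, k, x; split.
- by rewrite mulf_neq0.
- apply: (same_up_to_affine hI) => t It.
  by rewrite -(fp t It); exact: df.
- apply: (same_up_to_ln hJ g (q - cst c) c _ k0) => t Jt.
  + by rewrite !fctE -oppr_eq0 opprB q0.
  + by apply: is_derive_eq (dg t Jt) _; rewrite !fctE subrKC.
  + have dqt := dq' t Jt; apply: is_derive_eq.
    by rewrite gk// !fctE; ring.
- have -> : (fun w => 5 * c / 2 * w + k^-1 * ln `|cos (x * w)|) =
    (fun w => 5 * c / 2 * w - (- k)^-1 * ln `|cos (x * w)|).
    by apply/funext => w; rewrite invrN mulNr opprK.
  have k0' : - k != 0 by rewrite oppr_eq0.
  apply: (same_up_to_ln_cos hK h (s - cst (5 * c / 2))
    (5 * c / 2) _ _ k0' x0) => t Kt.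
    by apply: is_derive_eq (dh t Kt) _; rewrite !fctE subrKC.
  have dst := ds' t Kt; apply: is_derive_eq.
  by rewrite x2 hk// !fctE /curv_coef; field.
Qed.

End MinimalEquation.

(** * Partial derivatives and mean curvature *)

Section Determinants.
Context {A : comNzRingType}.

Lemma det_mx22 (M : 'M[A]_2) : \det M = M 0 0 * M 1 1 - M 0 1 * M 1 0.
Proof.
rewrite (expand_det_row _ ord0) !big_ord_recl big_ord0 /cofactor !det_mx11.
rewrite !mxE /= addr0 expr0 expr1 mul1r mulN1r mulrN.
by congr (M _ _ * M _ _ - M _ _ * M _ _); apply: val_inj.
Qed.

Lemma det_mx33 (M : 'M[A]_3) :
  \det M = M 0 0 * (M 1 1 * M 2 2 - M 1 2 * M 2 1)
         - M 0 1 * (M 1 0 * M 2 2 - M 1 2 * M 2 0)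
         + M 0 2 * (M 1 0 * M 2 1 - M 1 1 * M 2 0).
Proof.
have E0 : ord0 = 0 :> 'I_3 by [].
have E1 : lift ord0 ord0 = 1 :> 'I_3 by apply: val_inj.
have E2 : lift ord0 (lift ord0 ord0) = 2 :> 'I_3 by apply: val_inj.
rewrite (expand_det_row _ ord0) !big_ord_recl big_ord0 /cofactor !det_mx22 !mxE.
have L (i : 'I_3) (j : 'I_2) (k : 'I_3) : bump i j = k -> lift i j = k.
  by move=> e; apply: val_inj.
rewrite E2 E1 E0 !(L 0 0 1 erefl, L 0 1 2 erefl, L 1 0 0 erefl,
  L 1 1 2 erefl, L 2 0 0 erefl, L 2 1 1 erefl).
(* The cofactor exponents are sums of ordinal values; as numerals they are readable by [ring]. *)
rewrite -[X in (-1) ^+ X * (M 1 1 * _ - _)]/0%N.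
rewrite -[X in (-1) ^+ X * (M 1 0 * M 2 2 - _)]/1%N.
rewrite -[X in (-1) ^+ X * (M 1 0 * M 2 1 - _)]/2%N.
by ring.
Qed.

End Determinants.

(** The rows are r_u, r_v, r_w when [a], [b], [c] are the values of f', g', h'. *)
Definition frame {R : realType} (a b c : R) : 'M[R]_(3, 4) :=
  \matrix_(i < 3, k < 4)
    nth 0 (nth [::] [:: [:: a; 1; 1; 1];
                        [:: b; 1; 1; -1];
                        [:: c; 6; -1; 1]] i) k.

(** * First and second partial derivatives of the parameterization *)

Lemma is_derive_mx {R : realType} {V : normedModType R} {m n : nat}
    (M : V -> 'M[R]_(m, n)) (D : 'M[R]_(m, n)) (x v : V) :
  (forall i j, is_derive x v (fun y => M y i j) (D i j)) -> is_derive x v M D.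
Proof.
move=> dM; have dvM : derivable M x v.
  by apply/derivable_mxP => i j; case: (dM i j).
apply: DeriveDef => //; rewrite derive_mx//; apply/matrixP => i j.
by rewrite mxE; case: (dM i j).
Qed.

Lemma is_derive_coord {R : realType} {n : nat} (f : R -> R) (x v : 'rV[R]_n)
    (j : 'I_n) (d : R) :
  is_derive (x 0 j) 1 f d ->
  is_derive x v (fun y : 'rV[R]_n => f (y 0 j)) (v 0 j * d).
Proof.
move=> [df fd]; pose c (y : 'rV[R]_n) := y 0 j.
have dc : differentiable c x by exact: differentiable_coord.
have df' : differentiable f (c x) by exact/derivable1_diffP.
have dfc : differentiable (f \o c) x by exact: differentiable_comp.
apply: DeriveDef; first exact: diff_derivable.
rewrite (deriveE v dfc) diff_comp//= (diff1E df') -(deriveE v dc).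
rewrite derive1E fd /GRing.scale /=; congr (_ * _).
have di : derivable (id : _ -> 'rV[R]_n) x v by exact: derivable_id.
have := derive_mx di; rewrite derive_id => /matrixP/(_ 0 j).
by rewrite mxE.
Qed.

(** All four coordinates of the parameterization have this shape; [c] absorbs the shift 5 pi / 6. *)
Lemma is_derive_separable {R : realType} (F0 F1 F2 : R -> R) (d0 d1 d2 c : R)
    (x : 'rV[R]_3) (i : 'I_3) :
  is_derive (x 0 0) 1 F0 d0 -> is_derive (x 0 1) 1 F1 d1 ->
  is_derive (x 0 2) 1 F2 d2 ->
  is_derive x (delta_mx 0 i)
    (fun y : 'rV[R]_3 => F0 (y 0 0) + F1 (y 0 1) + F2 (y 0 2) + c)
    (nth 0 [:: d0; d1; d2] i).
Proof.
move=> D0 D1 D2; pose v : 'rV[R]_3 := delta_mx 0 i.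
have e0 := is_derive_coord F0 x v 0 _ D0.
have e1 := is_derive_coord F1 x v 1 _ D1.
have e2 := is_derive_coord F2 x v 2 _ D2.
apply: is_derive_eq (is_deriveD (is_deriveD (is_deriveD e0 e1) e2)
  (is_derive_cst c x v)) _.
rewrite {e0 e1 e2} /v !mxE; case: i => -[|[|[|k]]] // hk /=; ring.
Qed.

Lemma partial_type4 {R : realType} (f g h : R -> R) (x : 'rV[R]_3)
    (a b c : R) (i : 'I_3) :
  is_derive (x 0 0) 1 f a -> is_derive (x 0 1) 1 g b ->
  is_derive (x 0 2) 1 h c ->
  partial i (translation_type4 f g h) x = row i (frame a b c).
Proof.
move=> df dg dh; rewrite /partial.
suff [_ ->] : is_derive x (delta_mx 0 i) (translation_type4 f g h)
  (row i (frame a b c)) by [].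
have lin (k t : R) : is_derive t 1 (k *: (id : R -> R)) k.
  by apply: is_derive_eq; exact: mulr1.
apply: is_derive_mx => r k; rewrite (ord1 r) {r}.
have -> : row i (frame a b c) 0 k = nth 0 (nth [::] [:: [:: a; b; c];
    [:: 1; 1; 6]; [:: 1; 1; - 1]; [:: 1; - 1; 1]] k) i.
  by rewrite !mxE; case: k => -[|[|[|[|k]]]] // hk; case: i => -[|[|[|]]].
case: k => -[|[|[|[|k]]]] // hk.
- rewrite (_ : (fun y => _) =
    (fun y : 'rV_3 => f (y 0 0) + g (y 0 1) + h (y 0 2) + 0)); last first.
    by apply/funext => y; rewrite mxE addr0.
  exact: is_derive_separable.
- rewrite (_ : (fun y => _) = (fun y : 'rV_3 => (1 *: id) (y 0 0) +
    (1 *: id) (y 0 1) + (6 *: id) (y 0 2) + 0)); last first.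
    by apply/funext => y; rewrite mxE !scale1r addr0.
  exact: is_derive_separable.
- rewrite (_ : (fun y => _) = (fun y : 'rV_3 => (1 *: id) (y 0 0) +
    (1 *: id) (y 0 1) + ((- 1) *: id) (y 0 2) + 0)); last first.
    by apply/funext => y; rewrite mxE !scale1r scaleN1r addr0.
  exact: is_derive_separable.
- rewrite (_ : (fun y => _) = (fun y : 'rV_3 => (1 *: id) (y 0 0) +
    ((- 1) *: id) (y 0 1) + (1 *: id) (y 0 2) + 5 * pi / 6)); last first.
    by apply/funext => y; rewrite mxE !scale1r scaleN1r.
  exact: is_derive_separable.
Qed.

Lemma open_box {R : realType} (I J K : set R) :
  open I -> open J -> open K -> open (box I J K).
Proof.
move=> oI oJ oK.
have -> : box I J K = (fun y : 'rV[R]_3 => y 0 0) @^-1` I `&`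
    (fun y : 'rV[R]_3 => y 0 1) @^-1` J `&` (fun y : 'rV[R]_3 => y 0 2) @^-1` K.
  by apply/seteqP; split=> y => [[? ? ?]|[[? ?] ?]].
by do ?apply: openI; apply: open_comp => // y _; exact: coord_continuous.
Qed.

(** Only x_1 can be nonlinear, and it is a sum of functions of separate variables, so mixed
    derivatives vanish and pure ones point along x_1. *)
Lemma partial_partial_type4 {R : realType} {I J K : set R}
    {f p dp g q dq h s ds : R -> R} (x : 'rV[R]_3) (i j : 'I_3) :
  open I -> open J -> open K ->
  (forall t, I t -> is_derive t 1 f (p t)) ->
  (forall t, I t -> is_derive t 1 p (dp t)) ->
  (forall t, J t -> is_derive t 1 g (q t)) ->
  (forall t, J t -> is_derive t 1 q (dq t)) ->
  (forall t, K t -> is_derive t 1 h (s t)) ->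
  (forall t, K t -> is_derive t 1 s (ds t)) ->
  box I J K x ->
  partial j (partial i (translation_type4 f g h)) x =
  ((i == j)%:R * nth 0 [:: dp (x 0 0); dq (x 0 1); ds (x 0 2)] i)
    *: delta_mx 0 0.
Proof.
move=> oI oJ oK df dp' dg dq' dh ds' xIJK.
pose T (y : 'rV[R]_3) := row i (frame (p (y 0 0)) (q (y 0 1)) (s (y 0 2))).
(* The formula for the first derivatives holds on an open box around [x], so it may be
   differentiated there. *)
have near_eq : \forall y \near x, T y = partial i (translation_type4 f g h) y.
  have := open_nbhs_nbhs (conj (open_box _ _ _ oI oJ oK) xIJK).
  apply: filterS => y [Iy Jy Ky]; symmetry; apply: partial_type4.
  - exact: df.
  - exact: dg.
  - exact: dh.
rewrite {1}/partial -(near_eq_derive _ near_eq).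
pose F y := nth 0 [:: p; q; s] i y.
case: xIJK => Ix Jx Kx.
suff [_ ->] : is_derive x (delta_mx 0 j) T
  (((i == j)%:R * nth 0 [:: dp (x 0 0); dq (x 0 1); ds (x 0 2)] i)
    *: delta_mx 0 0) by [].
apply: is_derive_mx => r k; rewrite (ord1 r) {r}.
have [->|k0] := eqVneq k 0.
  rewrite (_ : (fun y => _) = (fun y : 'rV_3 => F (y 0 i))); last first.
    apply/funext => y; rewrite !mxE /F.
    case: i {T near_eq F} => -[|[|[|k']]] //= hk;
    by congr (_ (y _ _)); apply: val_inj.
  have dF : is_derive (x 0 i) 1 F
      (nth 0 [:: dp (x 0 0); dq (x 0 1); ds (x 0 2)] i).
    rewrite /F; case: i {T near_eq F} => -[|[|[|k']]] //= hk.
    - by rewrite (_ : Ordinal hk = 0); [exact: dp'|exact: val_inj].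
    - by rewrite (_ : Ordinal hk = 1); [exact: dq'|exact: val_inj].
    - by rewrite (_ : Ordinal hk = 2); [exact: ds'|exact: val_inj].
  apply: is_derive_eq (is_derive_coord F x (delta_mx 0 j) i _ dF) _.
  by rewrite !mxE !eqxx mulr1.
rewrite (_ : (fun y => _) = cst (row i (frame 0 0 0) 0 k)); last first.
  apply/funext => y; rewrite /= !mxE.
  by case: i {T near_eq F} => -[|[|[|k']]] // hk; case: k k0 => -[|[|[|[|]]]].
by rewrite !mxE (negbTE k0) andbF mulr0; exact: is_derive_cst.
Qed.

(** * Fundamental forms and mean curvature *)

Lemma det_frame {R : realType} (a b c e : R) :
  \det (col_mx (frame a b c) (e *: delta_mx 0 0) : 'M[R]_4) = 14 * e.
Proof.
have -> : (col_mx (frame a b c) (e *: delta_mx 0 0) : 'M[R]_4) =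
    \matrix_(i < 4, k < 4) nth 0 (nth [::] [:: [:: a; 1; 1; 1];
      [:: b; 1; 1; -1]; [:: c; 6; -1; 1]; [:: e; 0; 0; 0]] i) k.
  apply/matrixP => i k; rewrite !mxE; case: splitP => j ->.
    by rewrite !mxE; case: j => -[|[|[|]]].
  rewrite (ord1 j) !mxE; case: k => -[|[|[|[|]]]] //= hk;
  by rewrite ?mulr1 ?mulr0.
(* The last row has only its first entry possibly nonzero, and the corresponding minor, made of
   constants, is -14. *)
rewrite (expand_det_row _ ord_max) !big_ord_recl big_ord0 !mxE /= !mul0r !addr0.
rewrite /cofactor det_mx33 !mxE /=; ring.
Qed.

(** The second form is diagonal, so the trace meets only the diagonal cofactors of the first form.
    The square root yields [|a - b|], so the formula with (a - b)^3 is recovered up to the sign of a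
    - b. *)
Lemma mean_curvature_diag {R : realType} (r : 'rV[R]_3 -> 'rV[R]_4)
    (x : 'rV[R]_3) (a b c d0 d1 d2 : R) : a - b != 0 ->
  (forall i, partial i r x = row i (frame a b c)) ->
  (forall i j, partial j (partial i r) x =
     ((i == j)%:R * nth 0 [:: d0; d1; d2] i) *: delta_mx 0 0) ->
  mean_curvature r x =
    2 / (147 * (a - b) ^+ 2 * `|a - b|) *
    (curv_coef b c * d0 + curv_coef a c * d1 + 2 * (a - b) ^+ 2 * d2).
Proof.
move=> ab r1 r2.
pose y (i : nat) := nth 0 [:: a; b; c] i.
pose z (i : nat) := nth 0 [:: 1; 1; 6] i : R.
pose t (i : nat) := nth 0 [:: 1; 1; - 1] i : R.
have GE : first_form r x = \matrix_(i, j) (y i * y j + z i * z j + t i * t j).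
  apply/matrixP => i j; rewrite !mxE /iso_dot !r1 !big_mkcond !big_ord_recl.
  rewrite big_ord0 !mxE /= !addr0 addrA /y /z /t.
  by case: i => -[|[|[|]]] // hi; case: j => -[|[|[|]]].
(* A Gram determinant: the square of the determinant 7 (b - a) of the frame projected along x_4. *)
have detG : \det (first_form r x) = (7 * (a - b)) ^+ 2.
  by rewrite GE det_mx33 !mxE /y /z /t /=; ring.
have unitG : first_form r x \in unitmx.
  by rewrite unitmxE detG unitfE expf_neq0// mulf_neq0// pnatr_eq0.
have frameE : \matrix_(k < 3) partial k r x = frame a b c.
  by apply/row_matrixP => i; rewrite rowK r1.
have hE : second_form r x = \matrix_(i, j)
    ((i == j)%:R * (2 * nth 0 [:: d0; d1; d2] i / `|a - b|)).
  apply/matrixP => i j; rewrite !mxE frameE r2 det_frame detG sqrtr_sqr normrM.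
  rewrite (ger0_norm (_ : 0 <= 7 :> R))//; field.
  by rewrite normr_eq0.
rewrite /mean_curvature hE /invmx unitG detG /mxtrace !big_ord_recl big_ord0.
rewrite !mxE !big_ord_recl !big_ord0 !mxE /= !mul0r !addr0 !add0r.
rewrite /cofactor !det_mx22 GE !mxE /= /y /z /t /=.
rewrite /curv_coef /bump /=; field.
by rewrite normr_eq0 ab.
Qed.

(** * Affine f, g, h parameterize an open part of a hyperplane *)

Lemma affine_hyperplane {R : realType} (I J K : set R) (f g h : R -> R)
    (a b c : R) :
  open I -> open J -> open K -> a - b != 0 ->
  (exists e, forall t, I t -> f t = a * t + e) ->
  (exists e, forall t, J t -> g t = b * t + e) ->
  (exists e, forall t, K t -> h t = c * t + e) ->
  exists P : set 'rV[R]_4, nonisotropic_hyperplane P /\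
    open_part P (translation_type4 f g h @` box I J K).
Proof.
move=> oI oJ oK ab [ef fE] [eg gE] [eh hE].
(* [n] is orthogonal to the rows of [frame a b c], and its x_4 entry is nonzero since a - b is; [d]
   is its product with the constant term of the parameterization. *)
pose n : 'rV[R]_4 := \row_(k < 4)
  nth 0 [:: 14; - 2 * (b + c); 2 * (b + c) - 7 * (a + b); - 7 * (a - b)] k.
pose d := 14 * (ef + eg + eh) - 7 * (a - b) * (5 * pi / 6).
have PE (y : 'rV[R]_4) : hyperplane n d y <->
    14 * y 0 0 - 2 * (b + c) * y 0 1 + (2 * (b + c) - 7 * (a + b)) * y 0 2
    - 7 * (a - b) * y 0 3 = d.
  rewrite /hyperplane /= !big_ord_recl big_ord0 !mxE /= addr0 !addrA !mulNr.
  have -> : ord0 = 0 :> 'I_4 by [].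
  have -> : lift ord0 ord0 = 1 :> 'I_4 by apply: val_inj.
  have -> : lift ord0 (lift ord0 ord0) = 2 :> 'I_4 by apply: val_inj.
  have -> : lift ord0 (lift ord0 (lift ord0 ord0)) = 3 :> 'I_4.
    exact: val_inj.
  by [].
(* [w], [u], [v] recover the parameters from x_2, x_3, x_4; by continuity, lying in the box is an
   open condition. *)
pose w (y : 'rV[R]_4) := (y 0 1 - y 0 2) / 7.
pose u (y : 'rV[R]_4) := (y 0 2 + y 0 3 - 5 * pi / 6) / 2.
pose v (y : 'rV[R]_4) := y 0 2 + w y - u y.
pose X (k : 'I_4) (y : 'rV[R]_4) : R := y 0 k.
have cX k : continuous (X k) by exact: coord_continuous.
have cw : continuous w.
  move=> y; apply: (@continuousM _ _ (X 1 - X 2) (cst 7^-1)).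
    by apply: continuousB; exact: cX.
  exact: cst_continuous.
have cu : continuous u.
  move=> y; apply: (@continuousM _ _ (X 2 + X 3 - cst (5 * pi / 6)) (cst 2^-1)).
    apply: continuousB; last exact: cst_continuous.
    by apply: continuousD; exact: cX.
  exact: cst_continuous.
have cv : continuous v.
  move=> y; apply: (@continuousB _ _ _ (X 2 + w) u); last exact: cu.
  by apply: continuousD; [exact: cX|exact: cw].
exists (hyperplane n d); split.
  split.
    exists n, d; split=> //; apply/eqP => /matrixP/(_ 0 0).
    by rewrite !mxE /= => /eqP; rewrite pnatr_eq0.
  pose y0 : 'rV[R]_4 := (d / 14) *: delta_mx 0 0.
  have y0P : hyperplane n d y0.
    by apply/PE; rewrite !mxE /=; field.
  move=> /(_ y0 1 y0P)/PE; rewrite !mxE /= => e.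
  by move/eqP: ab; apply; move: e; rewrite /d; lra.
exists (u @^-1` I `&` v @^-1` J `&` w @^-1` K); split.
  by apply: openI; [apply: openI|]; apply: open_comp.
have c0 x : translation_type4 f g h x 0 0 = f (x 0 0) + g (x 0 1) + h (x 0 2).
  by rewrite mxE.
have c1 x : translation_type4 f g h x 0 1 = x 0 0 + x 0 1 + 6 * x 0 2.
  by rewrite mxE.
have c2 x : translation_type4 f g h x 0 2 = x 0 0 + x 0 1 - x 0 2.
  by rewrite mxE.
have c3 x : translation_type4 f g h x 0 3 = x 0 0 - x 0 1 + x 0 2 + 5 * pi / 6.
  by rewrite mxE.
apply/seteqP; split=> [_ [x [Ix Jx Kx] <-]|y [/PE yP [[Iy Jy] Ky]]].
  split; first by apply/PE; rewrite c0 c1 c2 c3 fE// gE// hE// /d; ring.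
  have wx : w (translation_type4 f g h x) = x 0 2 by rewrite /w c1 c2; field.
  have ux : u (translation_type4 f g h x) = x 0 0 by rewrite /u c2 c3; field.
  have vx : v (translation_type4 f g h x) = x 0 1 by rewrite /v wx ux c2; ring.
  by rewrite /= ux vx wx.
pose x : 'rV[R]_3 := \row_(k < 3) nth 0 [:: u y; v y; w y] k.
have [x0 x1 x2] : [/\ x 0 0 = u y, x 0 1 = v y & x 0 2 = w y] by rewrite !mxE.
exists x; first by rewrite /box /= x0 x1 x2.
(* The hyperplane equation determines x_1, whose coefficient is 14. *)
have E0 : translation_type4 f g h x 0 0 = y 0 0.
  apply: (mulfI (_ : 14 != 0 :> R)); first by rewrite pnatr_eq0.
  rewrite c0 x0 x1 x2 fE// gE// hE//.
  move: yP; rewrite /d /v /u /w => yP.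
  lra.
have E1 : translation_type4 f g h x 0 1 = y 0 1.
  by rewrite c1 x0 x1 x2 /v /w; field.
have E2 : translation_type4 f g h x 0 2 = y 0 2.
  by rewrite c2 x0 x1 x2 /v; ring.
have E3 : translation_type4 f g h x 0 3 = y 0 3.
  by rewrite c3 x0 x1 x2 /v /u; field.
apply/rowP => k; case: k => -[|[|[|[|k]]]] // hk.
- by rewrite (_ : Ordinal hk = 0)//; exact: val_inj.
- by rewrite (_ : Ordinal hk = 1)//; exact: val_inj.
- by rewrite (_ : Ordinal hk = 2)//; exact: val_inj.
- by rewrite (_ : Ordinal hk = 3)//; exact: val_inj.
Qed.

(** * The classification *)

Lemma smooth_on_is_derive {R : realType} {I : set R} {f : R -> R} :
  smooth_on I f -> forall (n : nat) t, I t ->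
  is_derive t 1 f^`(n)%classic (f^`(n.+1)%classic t).
Proof.
by move=> sf n t It; rewrite derive1nS derive1E; apply: derivableP; exact: sf.
Qed.

Theorem theorem6p2 (R : realType) (I J K : set R) (f g h : R -> R)
    (hI : open_interval I) (hJ : open_interval J) (hK : open_interval K)
    (hf : smooth_on I f) (hg : smooth_on J g) (hh : smooth_on K h)
    (hreg : forall u v : R, I u -> J v -> f^`()%classic u - g^`()%classic v != 0)
    (hmin : forall p : 'rV[R]_3, box I J K p ->
       mean_curvature (translation_type4 f g h) p = 0) :
  (exists P : set 'rV[R]_4, nonisotropic_hyperplane P /\
     open_part P (translation_type4 f g h @` box I J K))
  \/
  (exists lambda mu xi : R,
     [\/ case_i lambda mu xi I J K f g h,
         case_i lambda mu xi J I K g f h,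
         case_ii lambda mu xi I J K f g h |
         case_ii lambda mu xi J I K g f h]).
Proof.
have df := smooth_on_is_derive hf 0; have ddf := smooth_on_is_derive hf 1.
have dg := smooth_on_is_derive hg 0; have ddg := smooth_on_is_derive hg 1.
have dh := smooth_on_is_derive hh 0; have ddh := smooth_on_is_derive hh 1.
rewrite /= in df dg dh ddf ddg ddh.
have hreg' u v : J u -> I v -> g^`()%classic u - f^`()%classic v != 0.
  by move=> Ju Iv; rewrite -oppr_eq0 opprB hreg.
have [[oI _ [u0 Iu0]] [oJ _ [v0 Jv0]] [oK _ _]] := And3 hI hJ hK.
have E : minimal_eq I J K f^`(1)%classic f^`(2)%classic g^`(1)%classic
    g^`(2)%classic h^`(1)%classic h^`(2)%classic.
  move=> u v w Iu Jv Kw.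
  pose x : 'rV[R]_3 := \row_(k < 3) nth 0 [:: u; v; w] k.
  have [x0 x1 x2] : [/\ x 0 0 = u, x 0 1 = v & x 0 2 = w] by rewrite !mxE.
  have xIJK : box I J K x by rewrite /box /= x0 x1 x2.
  have ab := hreg u v Iu Jv.
  have := hmin x xIJK.
  rewrite (mean_curvature_diag _ _ _ _ (h^`(1)%classic w) (f^`(2)%classic u)
    (g^`(2)%classic v) (h^`(2)%classic w) ab).
  (* The factor in front of the bracket is nonzero by regularity, so the bracket vanishes. *)
  - move=> e; apply: (mulfI _ (etrans e (esym (mulr0 _)))).
    rewrite mulf_neq0 ?pnatr_eq0// invr_neq0// mulf_neq0 ?normr_eq0//.
    by rewrite mulf_neq0 ?expf_neq0 ?pnatr_eq0.
  - by move=> i; apply: partial_type4; rewrite ?x0 ?x1 ?x2;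
      [exact: df|exact: dg|exact: dh].
  - move=> i j; rewrite -x0 -x1 -x2.
    exact: (partial_partial_type4 x i j oI oJ oK df ddf dg ddg dh ddh xIJK).
have plane : flat I J K f^`(2)%classic g^`(2)%classic h^`(2)%classic ->
    exists P : set 'rV[R]_4, nonisotropic_hyperplane P /\
     open_part P (translation_type4 f g h @` box I J K).
  move=> [f0 g0 h0].
  have [a fa] := eq_cst_of_derive0 hI _ _ ddf f0.
  have [b gb] := eq_cst_of_derive0 hJ _ _ ddg g0.
  have [c hc] := eq_cst_of_derive0 hK _ _ ddh h0.
  apply: (affine_hyperplane _ _ _ _ _ _ a b c oI oJ oK).
  - by rewrite -(fa u0)// -(gb v0)//; exact: hreg.
  - by apply: (is_derive_affine hI) => t It; rewrite -(fa t It); exact: df.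
  - by apply: (is_derive_affine hJ) => t Jt; rewrite -(gb t Jt); exact: dg.
  - by apply: (is_derive_affine hK) => t Kt; rewrite -(hc t Kt); exact: dh.
(* The equation is symmetric in f and g, so g'' = 0 is the case f'' = 0 with the roles exchanged. *)
have EC := minimal_eqC _ _ _ _ _ _ _ _ _ E.
have [f0|g0|h0] := second_derivative_vanishes hI hJ hK ddf ddg ddh hreg E.
- have [fl|[a [m [x c]]]] :=
    minimal_f_affine hI hJ hK df ddf dg ddg dh ddh hreg E f0.
    by left; exact: plane.
  by right; exists a, m, x; exact: Or41.
- have [[? ? ?]|[a [m [x c]]]] :=
    minimal_f_affine hJ hI hK dg ddg df ddf dh ddh hreg' EC g0.
    by left; exact: plane.
  by right; exists a, m, x; exact: Or42.
- have [fl|[a [m [x c]]]] :=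
    minimal_h_affine hI hJ hK df ddf dg ddg dh ddh E h0.
    by left; exact: plane.
  by right; exists a, m, x; exact: Or43.
Qed.
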